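(* Let $X,Y$ be Banach spaces, $P\in L(X)$ and $Q\in L(Y)$ with $P^2=P$. Let $M\colon D(M)\subseteq X\to Y$ be densely defined, linear and continuous, with closure (i.e. continuous extension to $X$) $\overline{M}$. Then the following statements are equivalent: (i) $\overline{M}$ is $P$-$Q$-compatible; (ii) $M$ is $\sigma(X,X')$-$\sigma(Y,Y')$-strongly $P$-$Q$-compatible.
   Context: For a Banach space $X$, $L(X)$ denotes the bounded linear operators on $X$, $X'$ the dual space, $|\cdot|$ the norm; $\sigma(X,X_1)$ is the weak topology on $X$ associated with a dual pair $\langle X,X_1\rangle$. Let $X,Y$ be Banach spaces, $P\in L(X)$, $Q\in L(Y)$, and $X_1,Y_1$ vector spaces such that $\langle X,X_1\rangle$ and $\langle Y,Y_1\rangle$ are separating dual pairs. Let $N\colon D(N)\subseteq X\to Y$ be a map. $N$ is $P$-$Q$-compatible if for all $f,g\in D(N)$, $Pf=Pg$ implies $Q(N(f)-N(g))=0$. $N$ is $\sigma(X,X_1)$-$\sigma(Y,Y_1)$-strongly $P$-$Q$-compatible if for all $R>0$ and all $y_1\in Y_1$ the map $(B_N(0,R),\tau_P)\to Y$, $f\mapsto Nf$, is uniformly continuous, where $Y$ carries the pseudometric $(u,v)\mapsto|\langle Q(u-v),y_1\rangle|$, $B_N(0,R):=\{f\in D(N):|f|+|Nf|<R\}$, and $\tau_P$ is the relative topology on $B_N(0,R)$ of the initial topology on $X$ induced by $X\ni x\mapsto Px\in(X,\sigma(X,X_1))$. This initial topology is a linear topology, and the uniform structure used is the one given by its zero neighbourhoods;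 thus uniform continuity means: for every $\varepsilon>0$ there is a zero neighbourhood $U$ of $X$ in this topology such that $f,g\in B_N(0,R)$, $f-g\in U$ imply $|\langle Q(Nf-Ng),y_1\rangle|<\varepsilon$. In the theorem, $X_1=X'$ and $Y_1=Y'$ with the canonical dual pairings. *)

(* Defs.v *)
(* MathComp-Analysis. *)
From HB Require Import structures.
From mathcomp Require Import all_boot all_order all_algebra complex.
From mathcomp Require Import all_classical all_reals topology normedtype.

Set Implicit Arguments.
Unset Strict Implicit.
Unset Printing Implicit Defensive.

Import Order.TTheory GRing.Theory Num.Theory.
Import numFieldNormedType.Exports.
Local Open Scope classical_set_scope.
Local Open Scope ring_scope.

(* Banach spaces are [completeNormedModType K] with [K] one of the two usual
   scalar fields. For [K = R[i]], norms are elements of [K], and [0 < r] forces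
   [r] to be a positive real, so radii and tolerances may be taken in [K]. *)
Variant real_or_complex (R : realType) : numFieldType -> Prop :=
| real_scalars : real_or_complex R (R : numFieldType)
| complex_scalars : real_or_complex R (R[i] : numFieldType).

Section Topologies.
Variables (K : numFieldType) (X : normedModType K) (X1 : Type).

(* The pairing is given by its values [b x x1] only: bilinearity and separation
   are not needed to define the topologies. *)
Definition sigma_topology (b : X -> X1 -> K^o) : topologicalType :=
  sup_topology (fun x1 : X1 =>
    Topological.on (initial_topology (fun x : X => b x x1))).

Definition tau_topology (b : X -> X1 -> K^o) (P : X -> X) : topologicalType :=
  initial_topology (P : X -> sigma_topology b).

End Topologies.

(* A map [N : D(N) -> Y], [D(N)] a subset of [X], is a pair of a set [D] and a
   function [N : X -> Y] whose values outside [D] are never used. *)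
Section Compatibility.
Variables (K : numFieldType) (X Y : normedModType K).
Variables (P : X -> X) (Q : Y -> Y) (D : set X) (N : X -> Y).

Definition compatible : Prop :=
  forall f g, D f -> D g -> P f = P g -> Q (N f - N g) = 0.

Definition graph_ball (r : K) : set X :=
  [set f | D f /\ `|f| + `|N f| < r].

Definition strongly_compatible (X1 Y1 : Type)
    (bX : X -> X1 -> K^o) (bY : Y -> Y1 -> K^o) : Prop :=
  forall r : K, 0 < r -> forall y1 : Y1, forall e : K, 0 < e ->
  exists2 U : set X, @nbhs _ (tau_topology bX P) (0 : X) U &
    forall f g, graph_ball r f -> graph_ball r g -> U (f - g) ->
      `|bY (Q (N f - N g)) y1| < e.

End Compatibility.

Definition dual (K : numFieldType) (X : normedModType K) : Type :=
  {x' : {linear X -> K^o} | continuous x'}.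

Definition dual_pairing (K : numFieldType) (X : normedModType K)
  (x : X) (x' : dual X) : K^o := sval x' x.

Section LinearMaps.
Variables (K : numFieldType) (X Y : normedModType K).
Variables (D : set X) (M : X -> Y).

Definition linear_subspace : Prop :=
  D 0 /\ forall (a : K) f g, D f -> D g -> D (a *: f + g).

Definition linear_on : Prop :=
  forall (a : K) f g, D f -> D g -> M (a *: f + g) = a *: M f + M g.

(* When [D] is dense there is at most one continuous extension, so that the
   choice made by [get] is immaterial. *)
Definition continuous_extension : X -> Y :=
  get [set F : X -> Y | continuous F /\ forall f, D f -> F f = M f].

End LinearMaps.

(* Main.v *)
(** Let F be the continuous linear extension of M. If F is P-Q-compatible, then
   Q F kills the range of 1 - P, that is Q F = Q F P; for y' in Y', the
   functional phi = y' Q F is in X', so [|phi (P x)| < e] defines a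
   neighbourhood of 0 in the topology induced by P and sigma(X,X'), which
   witnesses strong compatibility.
   Conversely, let P x = 0 and suppose Q F x <> 0. By Hahn-Banach some y' in Y'
   does not vanish at Q F x. Norm-approximate x by h in D: such h eventually lie
   in a fixed graph ball and in every neighbourhood of 0 for the induced
   topology, because P is norm continuous and P x = 0. Comparing h with 0 makes
   y' (Q M h) arbitrarily small, although it tends to y' (Q F x). *)
Require Import Defs.
From HB Require Import structures.
From mathcomp Require Import all_boot all_order all_algebra complex ring lra.
From mathcomp Require Import all_classical all_reals topology normedtype.

Set Implicit Arguments.
Unset Strict Implicit.
Unset Printing Implicit Defensive.

Import Order.TTheory GRing.Theory Num.Theory.
Import numFieldNormedType.Exports.
Local Open Scope classical_set_scope.
Local Open Scope ring_scope.

(** * The Hahn-Banach theorem for a real sublinear functional *)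

Section HahnBanach.
Variables (R : realType) (E : lmodType R) (p : E -> R).
Hypothesis p_subadd : forall x y, p (x + y) <= p x + p y.
Hypothesis p_hom : forall t x, 0 < t -> p (t *: x) = t * p x.

(** Partial functionals are encoded by their graphs, so that the union of a chain is a plain union
    of sets; single-valuedness then follows from domination by [p]. *)
Definition linear_graph (G : set (E * R)) : Prop :=
  forall t v w r s, G (v, r) -> G (w, s) -> G (t *: v + w, t * r + s).

Definition dominated_graph (G : set (E * R)) : Prop :=
  forall v r, G (v, r) -> r <= p v.

Lemma sublinear0 : p 0 = 0.
Proof. by have := @p_hom 2 0 (ltr0n _ 2); rewrite scaler0; lra. Qed.

Lemma linear_graph0 G v r : linear_graph G -> G (v, r) -> G (0, 0).
Proof.
by move=> Gl Gv; have := Gl (-1) _ _ _ _ Gv Gv; rewrite scaleN1r addNr mulN1r addNr.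
Qed.

Lemma linear_graphZ G t v r : linear_graph G -> G (v, r) -> G (t *: v, t * r).
Proof.
move=> Gl Gv; have := Gl t _ _ _ _ Gv (linear_graph0 Gl Gv).
by rewrite !addr0.
Qed.

(** Both [(0, r - s)] and [(0, s - r)] lie in [G], and [p 0 = 0] bounds both differences. *)
Lemma dominated_graph_fun G v r s : linear_graph G -> dominated_graph G ->
  G (v, r) -> G (v, s) -> r = s.
Proof.
move=> Gl Gd Gr Gs.
have := Gd _ _ (Gl (-1) _ _ _ _ Gs Gr); have := Gd _ _ (Gl (-1) _ _ _ _ Gr Gs).
by rewrite scaleN1r addNr sublinear0; lra.
Qed.

(** The value [c] at [x] must lie above every [s - p (w - x)] and below every [p (v + x) - r].
    Subadditivity puts the first family below the second, so the supremum of the first will do. *)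
Lemma extension_value G x : linear_graph G -> dominated_graph G -> G !=set0 ->
  exists c, forall t v r, G (v, r) -> r + t * c <= p (v + t *: x).
Proof.
move=> Gl Gd [[v0 r0] G0].
pose S := [set z.2 - p (z.1 - x) | z in G].
have Sub v r : G (v, r) -> ubound S (p (v + x) - r).
  move=> Gv _ [[w s] /= Gw <-].
  have := Gd _ _ (Gl 1 _ _ _ _ Gv Gw); rewrite scale1r mul1r.
  have -> : v + w = (v + x) + (w - x) by rewrite addrACA subrr addr0.
  by have := p_subadd (v + x) (w - x); lra.
have Ssup : has_sup S.
  split; first by exists (r0 - p (v0 - x)), (v0, r0).
  by exists (p (v0 + x) - r0); exact: Sub.
exists (sup S) => t v r Gv.
(* Dividing by the absolute value of [t] reduces to [t = -1], where [c] is an upper bound of [S],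
   and to [t = 1], where it is the least one. *)
have [t0|t0|->] := ltgtP t 0; last by rewrite mul0r scale0r !addr0; exact: Gd.
- have u0 : 0 < - t by lra.
  have Gw := linear_graphZ (- t)^-1 Gl Gv.
  have : (- t)^-1 * r - p ((- t)^-1 *: v - x) <= sup S.
    by apply: ub_le_sup; [exact: Ssup.2 | exists ((- t)^-1 *: v, (- t)^-1 * r)].
  rewrite -(ler_pM2l u0) mulrBr mulVKf ?gt_eqF// -p_hom//.
  rewrite scalerBr scalerA mulfV ?gt_eqF// scale1r scaleNr opprK mulNr.
  by lra.
- have Gw := linear_graphZ t^-1 Gl Gv.
  have : sup S <= p (t^-1 *: v + x) - t^-1 * r.
    by apply: ge_sup; [exact: Ssup.1 | exact: Sub].
  rewrite -(ler_pM2l t0) mulrBr mulVKf ?gt_eqF// -p_hom//.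
  rewrite scalerDr scalerA mulfV ?gt_eqF// scale1r.
  by lra.
Qed.

(** Zorn's lemma gives a maximal dominated graph above [G0]; a one-dimensional extension shows that
    it is total. *)
Theorem hahn_banach (G0 : set (E * R)) :
    linear_graph G0 -> dominated_graph G0 -> G0 !=set0 ->
  exists f : {linear E -> R^o},
    (forall x, f x <= p x) /\ (forall x r, G0 (x, r) -> f x = r).
Proof.
move=> G0l G0d G0n.
(* [good] holds of the empty graph because [Zorn_bigcup] also requires it of the
   union of the empty chain. *)
pose good G :=
  [/\ linear_graph G, dominated_graph G & G !=set0 -> G0 `<=` G].
have [F Fgood Ftot|G [[Gl Gd Gext] Gmax]] := @Zorn_bigcup _ good.
  split.
  - move=> t v w r s [A FA Av] [B FB Bw].
    have [AB|BA] := Ftot _ _ FA FB.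
    + by exists B => //; have [Bl _ _] := Fgood _ FB; apply: Bl => //; exact: AB.
    + by exists A => //; have [Al _ _] := Fgood _ FA; apply: Al => //; exact: BA.
  - by move=> v r [A FA Av]; have [_ Ad _] := Fgood _ FA; exact: Ad.
  - move=> [z [A FA Az]]; have [_ _ AG0] := Fgood _ FA.
    by move=> y G0y; exists A => //; apply: AG0 => //; exists z.
have Gn : G !=set0.
  apply: contrapT => /set0P/negP/negPn/eqP G_0.
  apply: (Gmax G0); last by split=> // _; exact: subset_refl.
  split=> [|G0G]; first by rewrite G_0; exact: sub0set.
  by have [z /G0G] := G0n; rewrite G_0.
have total x : exists r, G (x, r).
  have [c cP] := extension_value x Gl Gd Gn.
  (* [H] adjoins [x] with value [c]; maximality forces [H] back into [G]. *)
  pose H := [set z : E * R | exists t v r, G (v, r) /\ z = (v + t *: x, r + t * c)].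
  have GH : G `<=` H by move=> [v r] Gv; exists 0, v, r; rewrite scale0r mul0r !addr0.
  have Hgood : good H.
    split.
    - move=> t v w r s [a [v' [r' [Gv' [-> ->]]]]] [b [w' [s' [Gw' [-> ->]]]]].
      exists (t * a + b), (t *: v' + w'), (t * r' + s'); split; first exact: Gl.
      congr (_, _); last by ring.
      by rewrite scalerDr scalerDl scalerA addrACA.
    - by move=> _ _ [t [v [r [Gv [-> ->]]]]]; exact: cP.
    - by move=> _; apply: subset_trans GH; exact: Gext.
  have HG : H `<=` G.
    apply: contrapT => nHG; apply: (Gmax H) => //; split => //.
  exists c; apply: HG; exists 1, 0, 0; rewrite scale1r mul1r !add0r; split => //.
  by case: Gn => -[v r]; exact: linear_graph0.
pose f (x : E) : R^o := sval (cid (total x)).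
have fP x : G (x, f x) by rewrite /f; case: cid.
have fE x r : G (x, r) -> f x = r by move=> Gx; exact: dominated_graph_fun Gl Gd _ Gx.
have flin : linear f by move=> a u v; apply: fE; exact: Gl.
pose fL := HB.pack_for {linear E -> R^o} f
  (GRing.isLinear.Build R E R^o *:%R f flin).
exists fL; split => [x|x r G0x]; first exact: Gd.
by apply: fE; apply: Gext.
Qed.

End HahnBanach.

(** * Separation of points by the dual, over real and complex scalars *)

Lemma norm_bounded_linear_continuous (K : numFieldType) (V W : normedModType K)
    (f : {linear V -> W}) (C : K) :
  C \is Num.real -> (forall x, `|f x| <= C * `|x|) -> continuous f.
Proof.
move=> Creal fC; apply/bounded_linear_continuous/linear_boundedP.
near=> r => x; apply: le_trans (fC x) _; rewrite ler_wpM2r ?normr_ge0//; near: r;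
  exact: nbhs_pinfty_ge.
Unshelve. all: by end_near. Qed.

(** Extend [t *: y |-> t * p y] from the line through [y]. A seminorm on a bare module is used so
    that the result also applies to a complex norm after restriction of scalars. *)
Lemma norming_functional (R : realType) (E : lmodType R) (p : E -> R) (y : E) :
    (forall u v, p (u + v) <= p u + p v) ->
    (forall t u, p (t *: u) = `|t| * p u) ->
  exists f : {linear E -> R^o}, (forall u, `|f u| <= p u) /\ f y = p y.
Proof.
move=> pD pZ.
have p_hom t u : 0 < t -> p (t *: u) = t * p u by move=> t0; rewrite pZ gtr0_norm.
have [|||f [fp fG]] := @hahn_banach _ _ _ pD p_hom
    [set z | exists t, z = (t *: y, t * p y)].
- move=> t v w r s [a [-> ->]] [b [-> ->]]; exists (t * a + b).
  by rewrite scalerDl scalerA mulrDl mulrA.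
- move=> v r [t [-> ->]]; rewrite pZ ler_wpM2r ?ler_norm//.
  have := pD y (- y); rewrite subrr -(scale0r y) -(scaleN1r y) !pZ normr0 normrN1.
  by lra.
- by exists (0 *: y, 0 * p y), 0.
exists f; split=> [u|]; last by apply: fG; exists 1; rewrite scale1r mul1r.
rewrite ler_norml fp andbT lerNl -linearN (le_trans (fp _))// -scaleN1r pZ.
by rewrite normrN1 mul1r.
Qed.

Lemma real_dual_separates (R : realType) (X : normedModType R) (x : X) :
  x != 0 -> exists x' : dual X, dual_pairing x x' != 0.
Proof.
move=> x0.
have [f [fp fx]] := @norming_functional R X Num.norm x (@ler_normD _ X) (@normrZ _ X).
have fc : continuous f.
  by apply: (@norm_bounded_linear_continuous _ _ _ f 1) => // u; rewrite mul1r fp.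
by exists (exist _ f fc); rewrite /dual_pairing/= fx normr_eq0.
Qed.

(* [E] with its scalars restricted to [R], so that the real theorem applies. *)
Section Realify.
Variables (R : realType) (E : lmodType R[i]).

Definition realify : Type := E.
HB.instance Definition _ := GRing.Zmodule.on realify.

Definition realify_scale (t : R) (u : realify) : realify := (t%:C)%C *: (u : E).

Fact realify_scaleA a b u :
  realify_scale a (realify_scale b u) = realify_scale (a * b) u.
Proof. by rewrite /realify_scale scalerA -rmorphM. Qed.

Fact realify_scale1 : left_id 1 realify_scale.
Proof. by move=> u; rewrite /realify_scale rmorph1 scale1r. Qed.

Fact realify_scaleDr : right_distributive realify_scale +%R.
Proof. by move=> a u v; rewrite /realify_scale scalerDr. Qed.

Fact realify_scaleDl u : {morph realify_scale^~ u : a b / a + b}.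
Proof. by move=> a b; rewrite /realify_scale rmorphD scalerDl. Qed.

HB.instance Definition _ := GRing.Zmodule_isLmodule.Build R realify
  realify_scaleA realify_scale1 realify_scaleDr realify_scaleDl.

End Realify.

(* The complex functional whose real part is [f]. *)
Definition complexify (R : realType) (E : lmodType R[i])
    (f : realify E -> R) (u : E) : R[i]^o := Complex (f u) (- f ('i%C *: u)).

Lemma complexify_linear (R : realType) (E : lmodType R[i])
  (f : {linear realify E -> R^o}) : linear (complexify f).
Proof.
have fZ (a : R[i]) (u : E) :
    f (a *: u) = complex.Re a * f u + complex.Im a * f ('i%C *: u) :> R.
  have -> : a *: u = (complex.Re a *: (u : realify E)) +
                     (complex.Im a *: ('i%C *: u : realify E)) :> realify E.
    by rewrite {1}[a]complexE scalerDl mulrC -scalerA.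
  by rewrite linearD !linearZ.
have fD (u v : E) : f (u + v : E) = f u + f v :> R by exact: (linearD f).
have fiD a u v : f ('i%C *: (a *: u + v : E)) =
    - complex.Im a * f u + complex.Re a * f ('i%C *: u) + f ('i%C *: v) :> R.
  by rewrite scalerDr fD scalerA fZ [_ * a]mulrC ReiNIm ImiRe.
move=> a u v; rewrite /complexify fiD fD (fZ a u).
apply/eqP; rewrite eq_complex /=.
case: a => s t; apply/andP; split; apply/eqP; rewrite /=; ring.
Qed.

Lemma complex_dual_separates (R : realType) (X : normedModType R[i]) (x : X) :
  x != 0 -> exists x' : dual X, dual_pairing x x' != 0.
Proof.
move=> x0.
pose p (u : realify X) : R := complex.Re `|u : X|.
have normE (u : X) : `|u| = ((p u)%:C)%C by rewrite RRe_real// normr_real.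
have pD (u v : realify X) : p (u + v) <= p u + p v.
  by rewrite -lecR rmorphD/= -!normE ler_normD.
have normC (t : R) : `|(t%:C)%C : R[i]| = ((`|t|)%:C)%C.
  by rewrite normc_def/= expr0n/= addr0 sqrtr_sqr.
have normi : `|'i%C : R[i]| = 1 by rewrite normc_def/= expr0n expr1n add0r sqrtr1.
have pZ t (u : realify X) : p (t *: u) = `|t| * p u.
  by apply: complexI; rewrite rmorphM/= -!normE normrZ normC.
have pi u : p ('i%C *: (u : X)) = p u.
  by apply: complexI; rewrite -!normE normrZ normi mul1r.
have [f [fp fx]] := @norming_functional R (realify X) p x pD pZ.
pose g : {linear X -> R[i]^o} := HB.pack_for {linear X -> R[i]^o} (complexify f)
  (GRing.isLinear.Build R[i] X R[i]^o *:%R (complexify f) (complexify_linear f)).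
have gc : continuous g.
  (* The constant 2 comes from bounding the real and imaginary parts separately, each by the norm of
     [u]. *)
  apply: (@norm_bounded_linear_continuous _ _ _ g 2); first exact: realn.
  move=> u /=; rewrite normE mulr_natl mulr2n [complexify f u]complexE.
  apply: le_trans (ler_normD _ _) _; rewrite normrM normi mul1r !normC.
  apply: lerD; rewrite lecR/=; first exact: fp.
  by rewrite normrN -(pi u); exact: fp.
exists (exist _ g gc); rewrite /dual_pairing/=.
apply: contra_neq x0 => /(congr1 (@complex.Re R))/= fx0.
by apply/normr0_eq0; rewrite normE -fx fx0.
Qed.

Lemma dual_separates (R : realType) (K : numFieldType)
    (X : normedModType K) (x : X) :
  real_or_complex R K -> x != 0 -> exists x' : dual X, dual_pairing x x' != 0.
Proof.
move=> hK; case: K / hK X x => X x.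
  exact: real_dual_separates.
exact: complex_dual_separates.
Qed.

(** * Dense subsets and the continuous linear extension *)

Lemma dense_closure (T : topologicalType) (D : set T) (x : T) :
  dense D -> closure D x.
Proof.
move=> Dd B; rewrite nbhsE => -[O [oO Ox] OB].
have [y [Oy Dy]] := Dd O (ex_intro _ x Ox) oO.
by exists y; split=> //; exact: OB.
Qed.

Lemma continuous_dense_eq (T U : topologicalType) (D : set T) (f g : T -> U) :
    hausdorff_space U -> dense D -> continuous f -> continuous g ->
  {in D, f =1 g} -> f =1 g.
Proof.
move=> hU Dd fc gc fg x.
have PF : ProperFilter (within D (nbhs x)).
  by apply: within_nbhs_proper; exact: dense_closure.
have cf : f @ within D (nbhs x) --> f x by apply: cvg_within_filter; exact: fc.
have cg : g @ within D (nbhs x) --> g x by apply: cvg_within_filter; exact: gc.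
apply: (cvg_unique hU cf); apply: cvg_trans cg.
by apply: fmap_within_eq => y Dy; rewrite fg.
Qed.

Section ContinuousExtension.
Variables (K : numFieldType) (X : normedModType K) (Y : completeNormedModType K).
Variables (D : set X) (M : X -> Y).
Hypotheses (Dsub : linear_subspace D) (Ddense : dense D).
Hypotheses (Mlin : linear_on D M) (Mcont : {within D, continuous M}).

Let linear_onB f g : D f -> D g -> D (g - f) /\ M (g - f) = M g - M f.
Proof.
move=> Df Dg; have [_ Dl] := Dsub.
have := Dl (-1) _ _ Df Dg; have := Mlin (-1) Df Dg.
by rewrite !scaleN1r ![- _ + _]addrC.
Qed.

Let linear_on0 : M 0 = 0.
Proof. by have [D0 _] := Dsub; have [_] := linear_onB D0 D0; rewrite !subrr. Qed.

Let within_proper (x : X) : ProperFilter (within D (nbhs x)).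
Proof. by apply: within_nbhs_proper; exact: dense_closure. Qed.

(** By linearity, continuity at 0 is already uniform. *)
Let M_unif_continuous e : 0 < e -> exists2 d, 0 < d &
  forall f g, D f -> D g -> `|f - g| < d -> `|M f - M g| < e.
Proof.
move=> e0; have [D0 _] := Dsub.
have M0 := (subspace_continuousP D M).1 Mcont 0 D0.
have /cvgrPdist_lt/(_ e e0) := M0.
rewrite linear_on0 => {M0} /nbhs_normP[d d0 dP].
exists d => // f g Df Dg fg; have [Dfg <-] := linear_onB Dg Df.
by have := dP (f - g); rewrite /= !sub0r !normrN; apply.
Qed.

(** Uniform continuity makes the image filter Cauchy, and [Y] is complete. *)
Let M_within_cvg (x : X) : cvg (M @ within D (nbhs x)).
Proof.
have PF := within_proper x.
apply: cauchy_cvg; apply: cauchy_exP => e e0.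
have [d d0 dP] := M_unif_continuous e0.
have d2 : 0 < d / 2 by rewrite divr_gt0.
have xd : nbhs x (ball x (d / 2)) by exact: nbhsx_ballx.
have [g [Dg xg]] := dense_closure Ddense xd.
exists (M g); rewrite nbhs_simpl /within/=; near=> f => Df.
have : ball g d f by apply: (@ball_splitr _ _ x) => //; near: f.
by rewrite -!ball_normE/=; exact: dP.
Unshelve. all: by end_near. Qed.

Lemma continuous_extension_exists :
  exists F : X -> Y, continuous F /\ forall f, D f -> F f = M f.
Proof.
exists (fun x : X => lim (M @ within D (nbhs x))); split=> [x|f Df]; last first.
  have PF := within_proper f.
  apply: cvg_lim; first exact: norm_hausdorff.
  exact: (subspace_continuousP _ _).1 Mcont f Df.
apply/cvgrPdist_lt => e e0; have e2 : 0 < e / 2 by rewrite divr_gt0.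
have /cvgrPdist_lt/(_ _ e2)/nbhs_normP[d d0 dP] := M_within_cvg (x := x).
apply/nbhs_normP; exists d => // y /= xy.
have PF := within_proper y.
have /cvgrPdist_lt/(_ _ e2) yM := M_within_cvg (x := y).
have xf : \forall f \near within D (nbhs y), `|x - f| < d.
  apply: cvg_within; apply/nbhs_normP; exists (d - `|x - y|) => /=.
    by rewrite subr_gt0.
  by move=> f /=; rewrite ltrBrDl; apply: le_lt_trans; exact: ler_distD.
have Df : \forall f \near within D (nbhs y), D f by exact: withinT.
(* A single [f] in [D] near [y] has [M f] within [e / 2] of both limits, at [x] and at [y]. *)
have [f [[/= yf {}xf] {}Df]] := filter_ex (filterI (filterI yM xf) Df).
have {}xf := dP _ xf Df.
rewrite (splitr e) (le_lt_trans (ler_distD (M f) _ _))// ltrD//.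
by rewrite distrC.
Qed.

Lemma continuous_extensionP : continuous (continuous_extension D M) /\
  forall f, D f -> continuous_extension D M f = M f.
Proof. by have /getPex := continuous_extension_exists. Qed.

Lemma linear_continuous_extension : exists F : {linear X -> Y},
  [/\ continuous_extension D M = F, continuous F & forall f, D f -> F f = M f].
Proof.
have [Fc FM] := continuous_extensionP; have [_ Dl] := Dsub.
set F := continuous_extension D M in Fc FM *.
(* Linearity passes from [D] to [X] one variable at a time: first [v], then [u]. *)
have FD a u v : D u -> F (a *: u + v) = a *: F u + F v.
  move=> Du; move: v.
  apply: (@continuous_dense_eq _ _ D _ _ (@norm_hausdorff _ _) Ddense).
  - move=> v; apply: (@continuous_comp _ _ _ ( +%R (a *: u)) F); last exact: Fc.
    by apply: cvgD; [exact: cvg_cst|exact: cvg_id].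
  - by move=> v; apply: cvgD; [exact: cvg_cst|exact: Fc].
  - by move=> v /set_mem Dv; rewrite !FM//; [exact: Mlin|exact: Dl].
suff Fl : linear F.
  by exists (HB.pack_for {linear X -> Y} F (GRing.isLinear.Build K X Y *:%R F Fl)).
move=> a u v; move: u.
apply: (@continuous_dense_eq _ _ D _ _ (@norm_hausdorff _ _) Ddense).
- move=> u; apply: (@continuous_comp _ _ _ (fun u => a *: u + v) F); last exact: Fc.
  by apply: cvgD; [apply: cvgZr; exact: cvg_id|exact: cvg_cst].
- by move=> u; apply: cvgD; [apply: cvgZr; exact: Fc|exact: cvg_cst].
- by move=> u /set_mem Du; exact: FD.
Qed.

End ContinuousExtension.

(** * The topology induced by [P] compared with weak and norm neighbourhoods *)

Section Topologies.
Variables (K : numFieldType) (X : normedModType K) (P : {linear X -> X}).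

Lemma tau_nbhs_dual (x' : dual X) (e : K) : 0 < e ->
  @nbhs _ (tau_topology (@dual_pairing K X) P) (0 : X)
    [set x | `|dual_pairing (P x) x'| < e].
Proof.
move=> e0.
pose S := sigma_topology (@dual_pairing K X).
pose A := [set z : X | `|dual_pairing z x'| < e].
suff : nbhs (P 0 : S) A by exact: (@initial_continuous _ S P 0).
have /cvg_sup/(_ x') : nbhs (P 0 : S) --> (P 0 : S) by exact: cvg_id.
apply; rewrite linear0.
apply: (@initial_continuous X K^o (fun x => dual_pairing x x') 0 [set t | `|t| < e]).
rewrite /dual_pairing linear0 -nbhs_nbhs_norm; exists e => // t.
by rewrite /= sub0r normrN.
Qed.

(** The induced topology does not distinguish [x] from 0, and it is coarser than the norm topology
    because [P] is continuous from the norm to the weak topology. *)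
Lemma tau_nbhs_norm (U : set X) (x : X) : continuous P -> P x = 0 ->
  @nbhs _ (tau_topology (@dual_pairing K X) P) (0 : X) U -> nbhs x U.
Proof.
move=> Pc Px [_ [[A oA <-] A0 AU]].
pose S := sigma_topology (@dual_pairing K X).
have sP : (P : X -> S) @ x --> (P x : S).
  apply/cvg_sup => x'.
  have x'P : continuous (sval x' \o P).
    move=> y; apply: continuous_comp; [exact: Pc|exact: (svalP x')].
  exact: (@continuous_comp_initial _ _ _ (sval x') P x'P x).
apply: filterS AU _; apply: sP; rewrite Px -(linear0 P).
exact: open_nbhs_nbhs.
Qed.

End Topologies.

(** * The equivalence of the two compatibility notions *)

Theorem theorem2p0p3 (R : realType) (K : numFieldType)
  (hK : real_or_complex R K)
  (X Y : completeNormedModType K)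
  (P : {linear X -> X}) (hP : continuous P)
  (Q : {linear Y -> Y}) (hQ : continuous Q)
  (hPP : forall x : X, P (P x) = P x)
  (D : set X) (M : X -> Y)
  (hDsub : linear_subspace D) (hDdense : dense D)
  (hMlin : linear_on D M) (hMcont : {within D, continuous M}) :
  compatible P Q [set: X] (continuous_extension D M) <->
  strongly_compatible P Q D M (@dual_pairing K X) (@dual_pairing K Y).
Proof.
have [F [-> Fc FM]] := linear_continuous_extension hDsub hDdense hMlin hMcont.
have QFc : continuous (Q \o F).
  by move=> x; apply: continuous_comp; [exact: Fc|exact: hQ].
have phic (y' : dual Y) : continuous (sval y' \o (Q \o F)).
  by move=> x; apply: continuous_comp; [exact: QFc|exact: (svalP y')].
split=> [FPQ r r0 y' e e0|MPQ f g _ _ Pfg].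
  (* Since [P] is idempotent, it identifies [u] and [P u]. *)
  have QFP u : Q (F u) = Q (F (P u)).
    by have := FPQ u (P u) I I (esym (hPP u)); rewrite linearB => /subr0_eq.
  pose phi : dual X := exist _ (sval y' \o (Q \o F) : {linear X -> K^o}) (phic y').
  exists [set x | `|dual_pairing (P x) phi| < e]; first exact: tau_nbhs_dual.
  move=> f g [Df _] [Dg _] /=.
  by rewrite /dual_pairing/= -QFP linearB !FM.
apply/eqP; apply: contrapT => /negP QFfg0.
rewrite -linearB in QFfg0; set x := f - g in QFfg0.
have Px : P x = 0 by rewrite linearB Pfg subrr.
have [y'] := dual_separates hK QFfg0; rewrite -normr_gt0.
set e := `|_| => e0.
have e2 : 0 < e / 2 by rewrite divr_gt0.
(* The summand 1 leaves a margin of 1/2 for each of [h] and [F h] when [h] approximates [x]. *)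
pose r := `|x| + `|F x| + 1.
have r0 : 0 < r by rewrite ltr_wpDl ?addr_ge0.
have [U /(tau_nbhs_norm hP Px) xU MU] := MPQ r r0 y' (e / 2) e2.
have near_phi : \forall h \near x, `|sval y' (Q (F x)) - sval y' (Q (F h))| < e / 2.
  exact: (cvgrPdist_lt _ _).1 (phic y' x) _ e2.
have half0 : 0 < 1 / 2 :> K by rewrite divr_gt0.
have near_x : \forall h \near x, `|x - h| < 1 / 2.
  by apply/nbhs_normP; exists (1 / 2).
have near_Fx : \forall h \near x, `|F x - F h| < 1 / 2.
  exact: (cvgrPdist_lt _ _).1 (Fc x) _ half0.
have [h [Dh [[hphi [hx hFx]] Uh]]] :=
  dense_closure hDdense (filterI (filterI near_phi (filterI near_x near_Fx)) xU).
have D0 : D 0 by case: hDsub.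
(* The approximant [h] lies in [D], while [x] itself may not; strong compatibility is applied to [h]
   and 0. *)
have := MU h 0; rewrite subr0 -!FM// linear0 subr0.
have hh : graph_ball D M r h.
  split => //; rewrite -FM// /r [1]splitr addrACA ltrD//.
    by rewrite -{1}(subKr x h) (le_lt_trans (ler_normB _ _))// ltrD2l.
  by rewrite -{1}(subKr (F x) (F h)) (le_lt_trans (ler_normB _ _))// ltrD2l.
have h0 : graph_ball D M r 0 by split => //; rewrite -FM// linear0 !normr0 addr0.
move=> /(_ hh h0 Uh) yh.
(* Both [y' (Q (F x)) - y' (Q (F h))] and [y' (Q (F h))] are smaller than [e / 2] in absolute value,
   but their sum has absolute value [e]. *)
suff : e < e by rewrite ltxx.
rewrite {2}(splitr e); apply: le_lt_trans (ltrD hphi yh).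
by rewrite -[leLHS]/(`|sval y' (Q (F x))|)
  -{1}(subrK (sval y' (Q (F h))) (sval y' (Q (F x)))) ler_normD.
Qed.
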